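(* Let $(P,O)$ be a $\mathbb T$-labelled poset and let $Q$ and $R$ be finite convex subposets of $P$. Then the formal power series \[ K_{Q\wedge R,O}\,K_{Q\vee R,O}-K_{Q,O}\,K_{R,O} \] is monomial-positive.
   Context: Let $\mathbb P=\{1,2,\dots\}$. For elements $s,t$ of a poset $P$, write $s\lessdot t$ ($t$ covers $s$) if $s<t$ and there is no $r$ with $s<r<t$. Let $\mathbb T$ be the set of all weakly increasing functions $f:\mathbb P\to\mathbb Z\cup\{\infty\}$. A $\mathbb T$-labelling $O$ of $P$ assigns to each covering pair $s\lessdot t$ of $P$ a function $O(s,t)\in\mathbb T$; $(P,O)$ is then a $\mathbb T$-labelled poset. A subset $Q\subseteq P$ is convex if $s,t\in Q$ and $s\le r\le t$ imply $r\in Q$; it carries the induced order, and its covering relations are exactly the covering relations of $P$ between elements of $Q$. For convex $Q$, a $(Q,O)$-tableau is a map $\sigma:Q\to\mathbb P$ such that $\sigma(s)\le O(s,t)(\sigma(t))$ for every covering pair $s\lessdot t$ with $s,t\in Q$. For finite convex $Q$, $K_{Q,O}=\sum_{\sigma}\prod_{i\ge1}x_i^{\#\sigma^{-1}(i)}\in\mathbb Q[[x_1,x_2,\dots]]$, the sum over all $(Q,O)$-tableaux $\sigma$. A formal power series is monomial-positive if all its coefficients are nonnegative. For convex $Q$ and $s\in P\setminus Q$, write $s<Q$ if $s<t$ for some $t\in Q$, and $s>Q$ if $s>t$ for some $t\in Q$; write $s\sim Q$ if $s\in Q$ or $s$ is incomparable to every element of $Q$. For convex $Q,R$ define $Q\wedge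 R=\{s\in R: s<Q\}\cup\{s\in Q: s\sim R \text{ or } s<R\}$ and $Q\vee R=\{s\in Q: s>R\}\cup\{s\in R: s\sim Q\text{ or } s>Q\}$ (these are convex subposets of $P$). *)

(* Defs.v *)
From mathcomp Require Import all_boot all_order all_algebra finmap.
From mathcomp Require Import boolp classical_sets fsbigop.
From mathcomp Require Import monalg.

Set Implicit Arguments.
Unset Strict Implicit.
Unset Printing Implicit Defensive.
Import Order.TTheory GRing.Theory Num.Theory.

Local Open Scope fset_scope.
Local Open Scope ring_scope.

Definition pnat := {n : nat | (0 < n)%N}.

(* Z with a top element adjoined; None is the infinite element. *)
Definition zinf := option int.

Definition le_zinf (a b : zinf) : bool :=
  match a, b with
  | _, None => true
  | None, Some _ => false
  | Some x, Some y => x <= y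
  end.

Record TT := MkTT {
  TTfun :> pnat -> zinf;
  TT_incr : forall i j : pnat, (val i <= val j)%N ->
    le_zinf (TTfun i) (TTfun j)
}.

Section Tableaux.
Variables (d : Order.disp_t) (P : porderType d).
Implicit Types (Q R : {fset P}) (s t r : P).

Definition covers s t : Prop :=
  (s < t)%O /\ ~ (exists r, (s < r < t)%O).

(* Only the values at covering pairs are ever used, so a labelling is given as
   a total function with irrelevant values at the other pairs. *)
Definition labelling := P -> P -> TT.

Definition convex Q : Prop :=
  forall s t r, s \in Q -> t \in Q -> (s <= r <= t)%O -> r \in Q.

(* Since Q is convex in P, its covering pairs are those of P lying in Q. *)
Definition tableau Q (O : labelling) (sigma : {ffun Q -> pnat}) : Prop :=
  forall s t : Q, covers (val s) (val t) ->
    le_zinf (Some (val (sigma s))%:Z) (O (val s) (val t) (sigma t)).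

Definition below s Q : bool :=
  (s \notin Q) && [exists t : Q, (s < val t)%O].

Definition above s Q : bool :=
  (s \notin Q) && [exists t : Q, (val t < s)%O].

Definition sim s Q : bool :=
  (s \in Q) || [forall t : Q, (s >< val t)%O].

Definition wedge Q R : {fset P} :=
  [fset s in R | below s Q] `|` [fset s in Q | sim s R || below s R].

Definition vee Q R : {fset P} :=
  [fset s in Q | above s R] `|` [fset s in R | sim s Q || above s Q].

(* The monomial prod_i x_i ^ #sigma^-1(i). *)
Definition weight Q (sigma : {ffun Q -> pnat}) : {cmonom pnat} :=
  [cmonom #|[set s | sigma s == i]| | i in [fset sigma s | s : Q]]%M.

End Tableaux.

(* Elements of Q[[x_1, x_2, ...]], as the function giving the coefficient of
   each monomial. *)
Definition fps := {cmonom pnat} -> rat.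

(* Finite sum: a monomial has finitely many factorizations. *)
Definition fps_mul (F G : fps) : fps := fun m =>
  \sum_(p \in [set p : {cmonom pnat} * {cmonom pnat} | mmul p.1 p.2 = m])
    F p.1 * G p.2.

Definition fps_sub (F G : fps) : fps := fun m => F m - G m.

Definition monomial_positive (F : fps) : Prop := forall m, 0 <= F m.

(* The sum over all tableaux of their monomials, taken coefficientwise; only
   finitely many sigma have a given weight, so each coefficient is a finite
   sum. *)
Definition K (d : Order.disp_t) (P : porderType d) (Q : {fset P})
    (O : labelling P) : fps := fun m =>
  \sum_(sigma \in [set sigma : {ffun Q -> pnat} | tableau O sigma])
    ((weight sigma == m)%:R : rat).

(* Main.v *)
(* Extend tableaux of Q and R to partial functions a, b on P and exchange their
   values on a set T of transferred cells.  The exchange may break a tableau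
   condition only at a covering pair separated by T, so call a covering pair
   linked when one of its two mixed conditions (a against b, b against a) fails;
   exchanging on a union of linked components keeps both tableaux valid.  Take
   T generated by the cells that must change sides, namely those of R below Q
   and those of Q above R.  The cells with a < b together with these form a
   linked-closed set, so T never reaches a cell that must stay, and the new
   domains are exactly the wedge and the vee.  The linked relation is unchanged
   by the exchange, so T, and hence (a, b), is recovered from the image: the
   transfer is a weight-preserving injection of pairs of tableaux. *)
From mathcomp Require Import all_boot all_order all_algebra finmap.
From mathcomp Require Import boolp classical_sets functions cardinality fsbigop.
From mathcomp Require Import monalg.
Require Import Defs.

Set Implicit Arguments.
Unset Strict Implicit.
Unset Printing Implicit Defensive.
Import Order.TTheory GRing.Theory Num.Theory.

Local Open Scope fset_scope.

Lemma le_zinf_trans u v w : le_zinf u v -> le_zinf v w -> le_zinf u w.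
Proof. by case: u v w => [x|] [y|] [z|] //=; apply: le_trans. Qed.

Lemma fsum1_le (I : choiceType) (A B : set I) :
  finite_set B -> (A `<=` B)%classic ->
  (\sum_(x \in A) (1 : rat) <= \sum_(x \in B) (1 : rat))%R.
Proof.
move=> finB AB; have finA := sub_finite_set AB finB.
have sum1 (C : set I) : finite_set C ->
    (\sum_(x \in C) (1 : rat) = #|` fset_set C|%:R)%R.
  by move=> finC; rewrite fsbig_finite // card_fset_sum1 natr_sum.
rewrite !sum1 // ler_nat.
by apply: fsubset_leq_card; rewrite -fset_set_sub.
Qed.

Arguments le_zinf : simpl never.

(** * Exchanging partial tableaux along linked components *)

Section Transfer.
Variables (d : Order.disp_t) (P : porderType d) (O : labelling P).
Implicit Types (Q R U : {fset P}) (a b : P -> option pnat) (x y : P).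

(** An undefined end imposes no condition, so only covering pairs inside the domain count. *)
Definition admissible (f : TT) (u v : option pnat) : bool :=
  match u, v with
  | Some i, Some j => le_zinf (Some (val i)%:Z%R) (f j)
  | _, _ => true
  end.

Definition partial_tableau a : Prop :=
  forall x y, covers x y -> admissible (O x y) (a x) (a y).

Definition linked a b x y : Prop :=
  covers x y /\
  ~~ (admissible (O x y) (a x) (b y) && admissible (O x y) (b x) (a y)).

Inductive generated (S : P -> Prop) (e : P -> P -> Prop) : P -> Prop :=
| generated_seed x : S x -> generated S e x
| generated_up x y : e x y -> generated S e x -> generated S e y
| generated_down x y : e x y -> generated S e y -> generated S e x.

Definition swap (T : P -> Prop) a b : P -> option pnat :=
  fun x => if `[< T x >] then b x else a x.

Lemma swapK T a b : swap T (swap T a b) (swap T b a) = a.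
Proof. by apply/funext => x; rewrite /swap; case: `[< T x >]. Qed.

Section Closed.
Variables (T : P -> Prop) (a b : P -> option pnat).
Hypotheses (ha : partial_tableau a) (hb : partial_tableau b).
Hypothesis T_linked : forall x y, linked a b x y -> T x <-> T y.

Lemma unlinked_admissible x y : covers x y -> `[< T x >] != `[< T y >] ->
  admissible (O x y) (a x) (b y) && admissible (O x y) (b x) (a y).
Proof.
move=> cxy; apply: contraNT => nadm.
by apply/eqP/asbool_equiv_eq; apply: T_linked; split.
Qed.

Lemma partial_tableau_swap : partial_tableau (swap T a b).
Proof.
move=> x y cxy; rewrite /swap; have := unlinked_admissible cxy.
by case: `[< T x >]; case: `[< T y >] => /= h;
  [apply: hb | case/andP: (h isT) | case/andP: (h isT) | apply: ha].
Qed.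

(** For ends on the same side of [T], the two mixed conditions stay or trade places. For separated
    ends, the new mixed conditions are the tableau conditions of [a] and [b], so the pair is linked
    neither before nor after. *)
Lemma linked_swap : linked (swap T a b) (swap T b a) = linked a b.
Proof.
apply/funext => x; apply/funext => y; apply/propext.
rewrite /linked /swap; split=> -[cxy]; have := unlinked_admissible cxy;
  have := ha cxy; have := hb cxy;
  case: `[< T x >]; case: `[< T y >] => /= h1 h2 h3;
  rewrite ?h1 ?h2 //= => h; split=> //; first by rewrite andbC.
- by rewrite andbC.
- by move: h; rewrite h3.
- by move: h; rewrite h3.
Qed.

End Closed.

Lemma generated_linked S a b x y :
  linked a b x y -> generated S (linked a b) x <-> generated S (linked a b) y.
Proof. by move=> l; split; [apply: generated_up | apply: generated_down]. Qed.

(** * Membership in the wedge and the vee *)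

Definition seed Q R x : bool :=
  (x \in R) && below x Q || (x \in Q) && above x R.

Lemma belowP x Q : reflect (x \notin Q /\ exists2 t, t \in Q & (x < t)%O)
  (below x Q).
Proof.
apply: (iffP andP) => -[xQ].
  by case/existsP=> t xt; split=> //; exists (val t) => //; apply: valP.
by case=> t tQ xt; split=> //; apply/existsP; exists [` tQ].
Qed.

Lemma aboveP x Q : reflect (x \notin Q /\ exists2 t, t \in Q & (t < x)%O)
  (above x Q).
Proof.
apply: (iffP andP) => -[xQ].
  by case/existsP=> t xt; split=> //; exists (val t) => //; apply: valP.
by case=> t tQ xt; split=> //; apply/existsP; exists [` tQ].
Qed.

Lemma below_in x Q : x \in Q -> below x Q = false.
Proof. by rewrite /below => ->. Qed.

Lemma above_in x Q : x \in Q -> above x Q = false.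
Proof. by rewrite /above => ->. Qed.

Lemma simE x Q : x \notin Q -> sim x Q = ~~ (below x Q || above x Q).
Proof.
move=> xQ; rewrite /sim (negPf xQ) /=; apply/forallP/idP => [s|].
  by apply/orP => -[/belowP|/aboveP] [_ [t tQ xt]]; have := s [` tQ];
    rewrite /=; case: comparableP xt.
rewrite negb_or => /andP[nbe nab] t; case: (comparableP x (val t)) => // xt.
- by case/negP: nbe; apply/belowP; split=> //; exists (val t) => //; apply: valP.
- by case/negP: nab; apply/aboveP; split=> //; exists (val t) => //; apply: valP.
- by move: xQ; rewrite xt (valP t).
Qed.

Lemma convex_between x Q : convex Q -> ~~ (below x Q && above x Q).
Proof.
move=> cQ; apply/andP => -[/belowP[xQ [t tQ xt]] /aboveP[_ [s sQ sx]]].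
by case/negP: xQ; apply: (cQ s t) => //; rewrite !ltW.
Qed.

(** Off a convex [R] no cell is both below and above [R], so being [sim] or below means not being
    above. A cell lying in only one of [Q], [R] is then placed by [seed] alone. *)
Lemma in_wedge Q R x : convex R -> (x \in wedge Q R) =
  if x \in Q then (x \in R) || ~~ above x R else (x \in R) && below x Q.
Proof.
move=> cR; rewrite !inE /=; case: (boolP (x \in R)) => xR.
  by rewrite /sim xR /below; case: (x \in Q); rewrite /= ?orbF.
by rewrite (simE xR) /=; move: (convex_between x cR);
  case: (x \in Q); case: (below x R); case: (above x R).
Qed.

Lemma in_vee Q R x : convex Q -> (x \in vee Q R) =
  if x \in R then (x \in Q) || ~~ below x Q else (x \in Q) && above x R.
Proof.
move=> cQ; rewrite !inE /=; case: (boolP (x \in Q)) => xQ.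
  by rewrite /sim xQ /above; case: (x \in R); rewrite /= ?orbF.
by rewrite (simE xQ) /=; move: (convex_between x cQ);
  case: (x \in R); case: (below x Q); case: (above x Q).
Qed.

(** * Bounding the transferred set; domains after the exchange *)

Section Domains.
Variables (Q R : {fset P}) (a b : P -> option pnat).
Hypotheses (cQ : convex Q) (cR : convex R).
Hypotheses (domQ : forall x, isSome (a x) = (x \in Q)).
Hypotheses (domR : forall x, isSome (b x) = (x \in R)).
Hypotheses (ha : partial_tableau a) (hb : partial_tableau b).

(** False as soon as one side is undefined, so that [transfer_bound] reduces to [seed] outside the
    intersection of [Q] and [R]. *)
Definition option_lt (u v : option pnat) : bool :=
  if u is Some i then if v is Some j then (val i < val j)%N else false
  else false.

Definition transfer_bound x : bool := seed Q R x || option_lt (a x) (b x).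

Lemma le_zinf_left (i j : pnat) u : (val i <= val j)%N ->
  le_zinf (Some (val j)%:Z%R) u -> le_zinf (Some (val i)%:Z%R) u.
Proof. by move=> ij; apply: le_zinf_trans; rewrite /le_zinf lez_nat. Qed.

Lemma le_zinf_right (f : TT) (i j : pnat) u : (val i <= val j)%N ->
  le_zinf u (f i) -> le_zinf u (f j).
Proof. by move=> ij ui; apply: le_zinf_trans ui (TT_incr f ij). Qed.

(** When all four values exist, say with [a x < b x] and [b y <= a y], the condition on [b] yields
    both mixed ones, by lowering the left entry or, as [O x y] is increasing, raising the right one.
    The opposite case uses the condition on [a]. *)
Lemma transfer_bound_unlinked x y : covers x y ->
  transfer_bound x != transfer_bound y ->
  admissible (O x y) (a x) (b y) && admissible (O x y) (b x) (a y).
Proof.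
move=> cxy; have [xy _] := cxy; have := ha cxy; have := hb cxy.
have := domQ x; have := domR x; have := domQ y; have := domR y.
(* These four facts, two from [x < y] and two from convexity, decide whether an end lying in a
   single domain is a seed. *)
have belowx : y \in Q -> x \notin Q -> below x Q.
  by move=> yQ xQ; apply/belowP; split=> //; exists y.
have abovey : x \in R -> y \notin R -> above y R.
  by move=> xR yR; apply/aboveP; split=> //; exists x.
have nabovex : y \in R -> ~~ above x R.
  move=> yR; apply/aboveP => -[xR [r rR rx]]; case/negP: xR.
  by apply: (cR rR yR); rewrite !ltW.
have nbelowy : x \in Q -> ~~ below y Q.
  move=> xQ; apply/belowP => -[yQ [r rQ yr]]; case/negP: yQ.
  by apply: (cQ xQ rQ); rewrite !ltW.
rewrite /transfer_bound /seed.
case ax: (a x) => [i|]; case bx: (b x) => [i'|];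
case ay: (a y) => [j|]; case by_: (b y) => [j'|] /= yR yQ xR xQ;
rewrite -?yR -?yQ -?xR -?xQ /= in belowx abovey nabovex nbelowy * .
all: rewrite ?(negPf (nabovex isT)) ?(negPf (nbelowy isT)) ?(below_in (esym xQ))
  ?(above_in (esym yR)) ?(belowx isT isT) ?(abovey isT isT) ?(above_in (esym xR))
  ?(below_in (esym yQ)) ?orbF //=.
(* What remains: both ends in both domains, or one end in both and the other in exactly one. *)
- move=> hb' ha'; case: ltnP => ii; case: ltnP => // jj _; apply/andP; split.
  + exact: le_zinf_left (ltnW ii) (le_zinf_right _ hb').
  + exact: le_zinf_right jj hb'.
  + exact: le_zinf_right (ltnW jj) ha'.
  + exact: le_zinf_left ii ha'.
- by move=> _ ha'; case: ltnP => // ii _; apply: le_zinf_left ii ha'.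
- by move=> hb' _; case: ltnP => // ii _; rewrite andbT (le_zinf_left (ltnW ii)).
- by move=> _ ha'; case: ltnP => // jj _; rewrite andbT (le_zinf_right (ltnW jj)).
- by move=> hb' _; case: ltnP => // jj _; apply: le_zinf_right jj hb'.
Qed.

Lemma generated_bound x : generated (seed Q R) (linked a b) x ->
  transfer_bound x.
Proof.
have inv y z : linked a b y z -> transfer_bound y = transfer_bound z.
  case=> cyz nadm; apply/eqP; apply: contraNT nadm.
  exact: transfer_bound_unlinked.
by elim=> [y sy|y z /inv <-|y z /inv ->] //; rewrite /transfer_bound sy.
Qed.


Let T := generated (seed Q R) (linked a b).

(** With one of [a x], [b x] undefined, the upper bound of [generated_bound] collapses to the
    seeds. *)
Lemma generatedE x : (x \in Q) != (x \in R) -> `[< T x >] = seed Q R x.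
Proof.
move=> neq; apply/asboolP/idP => [/generated_bound/orP[//|]|]; last first.
  by move=> sx; apply: generated_seed.
move: neq; rewrite /option_lt -domQ -domR.
by case: (a x); case: (b x).
Qed.

(** A common cell stays in both domains whether or not it is exchanged; for the others [generatedE]
    applies. *)
Lemma dom_swap_wedge x : isSome (swap T a b x) = (x \in wedge Q R).
Proof.
rewrite in_wedge // /swap; case: (boolP ((x \in Q) == (x \in R))) => [/eqP E|].
  case: asboolP => _; rewrite ?domQ ?domR -?E;
  case: (boolP (x \in Q)) => //= xQ; rewrite -E (negPf xQ) //.
move=> E; rewrite generatedE // /seed.
case: (boolP (x \in Q)) (E) => xQ; case: (boolP (x \in R)) => xR //= _.
  by case: (above x R); rewrite ?domQ ?domR ?xQ ?(negPf xR).
by rewrite orbF; case: (below x Q); rewrite ?domQ ?domR ?xR ?(negPf xQ).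
Qed.

Lemma dom_swap_vee x : isSome (swap T b a x) = (x \in vee Q R).
Proof.
rewrite in_vee // /swap; case: (boolP ((x \in Q) == (x \in R))) => [/eqP E|].
  case: asboolP => _; rewrite ?domQ ?domR ?E;
  case: (boolP (x \in R)) => //= xR; rewrite E (negPf xR) //.
move=> E; rewrite generatedE // /seed.
case: (boolP (x \in Q)) (E) => xQ; case: (boolP (x \in R)) => xR //= _.
  by case: (above x R); rewrite ?domQ ?domR ?xQ ?(negPf xR).
by rewrite orbF; case: (below x Q); rewrite ?domQ ?domR ?xR ?(negPf xQ).
Qed.

End Domains.

(** * Tableaux as partial functions, and their weights *)

Definition extend Q (sigma : {ffun Q -> pnat}) : P -> option pnat :=
  fun x => omap sigma (insub x).

(** The default 1 is never read when [a] is defined on all of [Q]. *)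
Definition restrict Q a : {ffun Q -> pnat} :=
  [ffun x => odflt (exist _ 1%N isT) (a (val x))].

Lemma extend_val Q (sigma : {ffun Q -> pnat}) (s : Q) :
  extend sigma (val s) = Some (sigma s).
Proof. by rewrite /extend valK. Qed.

Lemma dom_extend Q (sigma : {ffun Q -> pnat}) x :
  isSome (extend sigma x) = (x \in Q).
Proof. by rewrite /extend; case: insubP => [u -> //|/negPf ->]. Qed.

Lemma extendK Q : cancel (@extend Q) (@restrict Q).
Proof. by move=> sigma; apply/ffunP => s; rewrite ffunE extend_val. Qed.

Lemma restrictK Q a : (forall x, isSome (a x) = (x \in Q)) ->
  extend (restrict Q a) = a.
Proof.
move=> dom; apply/funext => x; rewrite /extend; have := dom x.
case: insubP => [u _ <-|/negPf ->]; last by case: (a x).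
by rewrite (valP u) /= ffunE; case: (a _).
Qed.

Lemma tableauE Q (sigma : {ffun Q -> pnat}) :
  tableau O sigma <-> partial_tableau (extend sigma).
Proof.
split=> [h x y|h s t st]; last first.
  by have := h _ _ st; rewrite !extend_val.
rewrite /extend; case: insubP => [s _ <-|_] //=; case: insubP => [t _ <-|_] //=.
exact: h.
Qed.

(** A common index set [U] lets weights over different domains be compared cell by cell. *)
Lemma weightE Q U (sigma : {ffun Q -> pnat}) i : Q `<=` U ->
  weight sigma i = (\sum_(x <- U) (extend sigma x == Some i))%N.
Proof.
move=> QU; rewrite cmE fsfun_fun /=.
transitivity #|[set s | sigma s == i]|.
  case: ifPn => // ni; symmetry; apply: eq_card0 => s; rewrite !inE.
  by apply: contraNF ni => /eqP <-; apply/imfsetP; exists s.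
rewrite -(big_fset_incl _ QU) => [|x _ xQ]; last first.
  by rewrite /extend insubN.
rewrite big_seq_fsetE /= -sum1_card big_mkcond /=.
by apply: eq_bigr => s _; rewrite extend_val inE; case: (_ == i) / eqP => [->|ne];
  rewrite ?eqxx //; case: eqP => // -[].
Qed.

Local Open Scope classical_set_scope.

Lemma finite_weight_sub Q (V : {fset pnat}) :
  finite_set [set sigma : {ffun Q -> pnat} | finsupp (weight sigma) `<=` V]%fset.
Proof.
pose incl (tau : {ffun Q -> V}) := [ffun s => val (tau s)] : {ffun Q -> pnat}.
apply: (@sub_finite_set _ _ (incl @` setT)); last first.
  by apply: finite_image; apply: finite_finset.
move=> sigma /= /fsubsetP sV.
have inV s : sigma s \in V.
  apply: sV; rewrite -cmE_neq0 (weightE (U := Q)) ?fsubset_refl //.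
  by rewrite big_seq_fsetE /= (bigD1 s) //= extend_val eqxx.
exists [ffun s => [` inV s]] => //.
by apply/ffunP => s; rewrite !ffunE.
Qed.

(** * Coefficients as numbers of tableaux and of pairs *)

Definition tableaux Q (m : {cmonom pnat}) : set {ffun Q -> pnat} :=
  [set sigma | tableau O sigma /\ weight sigma = m].

Definition tableau_pairs Q R (m : {cmonom pnat}) :
    set ({ffun Q -> pnat} * {ffun R -> pnat}) :=
  [set p | [/\ tableau O p.1, tableau O p.2 &
     mmul (weight p.1) (weight p.2) = m]].

Lemma finite_tableaux Q m : finite_set (@tableaux Q m).
Proof.
by apply: sub_finite_set (@finite_weight_sub Q (finsupp m)) => sigma [_ /= ->].
Qed.

Lemma finite_tableau_pairs Q R m : finite_set (@tableau_pairs Q R m).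
Proof.
apply: sub_finite_set (finite_setX (@finite_weight_sub Q (finsupp m))
  (@finite_weight_sub R (finsupp m))) => -[sigma tau] [_ _ /= <-].
by split; apply/fsubsetP => i; rewrite -!cmE_neq0 cmM addn_eq0 negb_and => ->;
  rewrite ?orbT.
Qed.

Lemma K_sum Q m : K Q O m = (\sum_(sigma \in @tableaux Q m) (1 : rat))%R.
Proof.
rewrite /K -(fsbig_widen (@tableaux Q m)); last 2 first.
- by move=> sigma [].
- by move=> sigma [/= t /not_andP[//|/eqP/negPf ->]].
by apply: eq_fsbigr => sigma; rewrite inE => -[_ ->]; rewrite eqxx.
Qed.

(** Pairs of tableaux are sorted by their pair of weights [h z], a factorization of [m]. *)
Lemma fps_mul_sum Q R m : fps_mul (K Q O) (K R O) m =
  (\sum_(p \in @tableau_pairs Q R m) (1 : rat))%R.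
Proof.
pose Y := @tableau_pairs Q R m.
have finY : finite_set Y by apply: finite_tableau_pairs.
pose h (z : {ffun Q -> pnat} * {ffun R -> pnat}) := (weight z.1, weight z.2).
have finhY : finite_set (h @` Y) by apply: finite_image.
have KK (p : {cmonom pnat} * {cmonom pnat}) : mmul p.1 p.2 = m ->
    (K Q O p.1 * K R O p.2 = \sum_(z \in Y) ((h z == p)%:R : rat))%R.
  move=> pm; rewrite !K_sum mulr_fsuml.
  under eq_fsbigr do rewrite mulr_fsumr.
  rewrite pair_fsbig; try exact: finite_tableaux.
  under eq_fsbigr do rewrite mulr1.
  transitivity (\sum_(z \in @tableaux Q p.1 `*` @tableaux R p.2)
      ((h z == p)%:R : rat))%R.
    apply: eq_fsbigr => z; rewrite inE => -[[_ w1] [_ w2]].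
    by rewrite /h w1 w2 -surjective_pairing eqxx.
  apply: fsbig_widen.
    by move=> z [[t1 w1] [t2 w2]]; split=> //; rewrite w1 w2.
  move=> z [[t1 t2 _] nz] /=; case: eqP => // hz; case: nz.
  by rewrite -hz; split; split.
(* Factorizations that are not weights of any pair contribute zero. *)
rewrite /fps_mul -(fsbig_widen (h @` Y) [set p | mmul p.1 p.2 = m]
  (fun p => K Q O p.1 * K R O p.2)%R); first last.
- move=> p [/= pm np]; rewrite KK //; apply: fsbig1 => z Yz.
  by case: eqP => // hz; case: np; exists z.
- by move=> _ [z [_ _ zm] <-].
rewrite (eq_fsbigr (fun p => (\sum_(z \in Y) ((h z == p)%:R : rat))%R)); last first.
  by move=> p; rewrite inE => -[z [_ _ zm] <-]; rewrite KK.
rewrite exchange_fsbig //; apply: eq_fsbigr => z; rewrite inE => Yz.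
(* For fixed [z] only the term [p = h z] survives. *)
rewrite -(fsbig_widen [set h z]); first last.
- by move=> p [_ /= np]; case: eqP => // hz; case: np.
- by move=> _ ->; exists z.
by rewrite fsbig_set1 eqxx.
Qed.

(** * The transfer map on pairs of tableaux *)

Definition transfer Q R (z : {ffun Q -> pnat} * {ffun R -> pnat}) :
    {ffun wedge Q R -> pnat} * {ffun vee Q R -> pnat} :=
  let a := extend z.1 in let b := extend z.2 in
  let T := generated (seed Q R) (linked a b) in
  (restrict (wedge Q R) (swap T a b), restrict (vee Q R) (swap T b a)).

Section TransferPairs.
Variables (Q R : {fset P}).
Hypotheses (cQ : convex Q) (cR : convex R).

Lemma transferP (z : {ffun Q -> pnat} * {ffun R -> pnat}) :
  tableau O z.1 -> tableau O z.2 ->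
  let a := extend z.1 in let b := extend z.2 in
  let T := generated (seed Q R) (linked a b) in
  extend (transfer z).1 = swap T a b /\ extend (transfer z).2 = swap T b a.
Proof.
move=> /tableauE ta /tableauE tb a b T.
by split; apply: restrictK => x; [apply: dom_swap_wedge|apply: dom_swap_vee] => // y;
  apply: dom_extend.
Qed.

Lemma transfer_inj (z z' : {ffun Q -> pnat} * {ffun R -> pnat}) :
  tableau O z.1 -> tableau O z.2 -> tableau O z'.1 -> tableau O z'.2 ->
  transfer z = transfer z' -> z = z'.
Proof.
move=> t1 t2 t1' t2' E.
have [e1 e2] := transferP t1 t2; have [] := transferP t1' t2'.
rewrite -E {}e1 {}e2; set a := extend z.1; set b := extend z.2.
set a' := extend z'.1; set b' := extend z'.2.
set T := generated _ _; set T' := generated _ _ => e1 e2.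
(* By [linked_swap] each set is generated by the linked relation of its swapped pair, and the
   swapped pairs agree. *)
have TT' : T = T'.
  rewrite /T /T' -(@linked_swap T a b) -1?(@linked_swap T' a' b') ?e1 ?e2 //;
    by [apply/tableauE | move=> x y; apply: generated_linked].
case: z z' @a @b @a' @b' @T @T' TT' {t1 t2 t1' t2' E} e1 e2
  => [s t] [s' t'] /= <- e1 e2.
congr pair; apply: (can_inj (@extendK _)).
  rewrite -[LHS](swapK (generated (seed Q R) (linked (extend s) (extend t)))
    _ (extend t)).
  by rewrite e1 e2 swapK.
rewrite -[LHS](swapK (generated (seed Q R) (linked (extend s) (extend t)))
  _ (extend s)).
by rewrite e1 e2 swapK.
Qed.

Lemma transfer_tableau_pairs m z :
  @tableau_pairs Q R m z -> @tableau_pairs (wedge Q R) (vee Q R) m (transfer z).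
Proof.
move=> [t1 t2 zm]; have [e1 e2] := transferP t1 t2.
have [p1 p2] := (iffLR (tableauE _) t1, iffLR (tableauE _) t2).
split; [apply/tableauE; rewrite e1|apply/tableauE; rewrite e2|].
- by apply: partial_tableau_swap => // x y; apply: generated_linked.
- apply: partial_tableau_swap => // x y /= [cxy].
  by rewrite andbC => nadm; apply: generated_linked; split.
rewrite -zm; apply/eqP/cmP => i; rewrite !cmM.
have sub_wedge : (wedge Q R `<=` Q `|` R)%fset.
  by apply/fsubsetP => x; rewrite in_wedge // inE; case: (x \in Q) => // /andP[].
have sub_vee : (vee Q R `<=` Q `|` R)%fset.
  by apply/fsubsetP => x; rewrite in_vee // inE; case: (x \in R);
    rewrite ?orbT // => /andP[->].
rewrite (weightE _ _ sub_wedge) (weightE _ _ sub_vee).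
rewrite (weightE _ _ (fsubsetUl Q R)) (weightE _ _ (fsubsetUr Q R)) e1 e2.
(* At each cell the exchange merely permutes the two contributions. *)
rewrite -!big_split; apply: eq_bigr => x _ /=; rewrite /swap.
by case: asboolP => // _; apply: addnC.
Qed.

End TransferPairs.
End Transfer.

Theorem mainTheorem1 (d : Order.disp_t) (P : porderType d) (O : labelling P)
    (Q R : {fset P}) (hQ : convex Q) (hR : convex R) :
  monomial_positive
    (fps_sub (fps_mul (K (wedge Q R) O) (K (vee Q R) O))
             (fps_mul (K Q O) (K R O))).
Proof.
move=> m; rewrite /fps_sub subr_ge0 !fps_mul_sum.
have inj : set_inj (@tableau_pairs _ _ O Q R m) (@transfer _ _ O Q R).
  move=> z z' /set_mem[t1 t2 _] /set_mem[t1' t2' _].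
  exact: transfer_inj.
rewrite -(fsbig_image _ _ (fun=> (1%R : rat)) inj).
apply: fsum1_le; first exact: finite_tableau_pairs.
by move=> _ [z zm <-]; apply: transfer_tableau_pairs.
Qed.
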